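(* Let $\rho=\{r_1,\dots,r_s\}$ be a set of natural numbers with $r_i>1$ for all $i$ and $\gcd(r_i,r_j)=1$ for $i\neq j$, let $n_0=\prod_{i=1}^s r_i$, and let \[ Q_\rho(z)=\prod_{I\subseteq\{1,\dots,s\}}\Bigl(z^{\,n_0/\prod_{i\in I}r_i}-1\Bigr)^{(-1)^{|I|}}. \] Let $D_\rho=\{d\in\mathbb N: d\mid n_0 \text{ and } \gcd(d,r_i)>1 \text{ for all } i=1,\dots,s\}$. Then \[ Q_\rho(z)=\prod_{d\in D_\rho}\Phi_d(z), \] where $\Phi_d$ denotes the $d$-th cyclotomic polynomial. *)

(* Defs.v *)
From mathcomp Require Import all_boot all_order all_algebra all_field.

Set Implicit Arguments.
Unset Strict Implicit.
Unset Printing Implicit Defensive.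

Import GRing.Theory.
Local Open Scope ring_scope.

Definition prod_rho (s : nat) (r : 'I_s -> nat) : nat :=
  (\prod_(i < s) r i)%N.

(* The factors with #|I| odd occur with exponent -1, so Q_rho is a priori only
   a rational function: it lives in the fraction field of {poly int}, and the
   outer ^ is the integer power. The division %/ on exponents is exact, since
   the product over I divides the product over all indices. *)
Definition Q_rho (s : nat) (r : 'I_s -> nat) : {fraction {poly int}} :=
  \prod_(I : {set 'I_s})
     tofrac ('X^(prod_rho r %/ \prod_(i in I) r i) - 1) ^ ((-1) ^+ #|I| : int).

(* A duplicate-free list; [divisors n] is the list of all divisors of n
   when 0 < n. *)
Definition D_rho (s : nat) (r : 'I_s -> nat) : seq nat :=
  [seq d <- divisors (prod_rho r) | [forall i : 'I_s, (1 < gcdn d (r i))%N]].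

(* Main.v *)
(* Factor each z^m - 1 as the product of the Phi_d with d | m, and collect, for
   each d | n_0, the exponent of Phi_d: it is the sum of (-1)^|I| over the I
   such that d divides n_0 / prod_(i in I) r_i. As the r_i are coprime, these
   are the subsets I of {i | gcd(d, r_i) = 1}, so the sum is 1 if no r_i is
   coprime to d, and 0 otherwise. *)
Require Import Defs.
From mathcomp Require Import all_boot all_order all_algebra all_field.

Set Implicit Arguments.
Unset Strict Implicit.
Unset Printing Implicit Defensive.

Import GRing.Theory.
Local Open Scope ring_scope.

Lemma prod_exprz (F : fieldType) (x : F) (I : Type) (s : seq I) (P : pred I)
    (e : I -> int) :
  x != 0 -> \prod_(i <- s | P i) x ^ e i = x ^ (\sum_(i <- s | P i) e i).
Proof.
by move=> x0; rewrite (big_morph _ (fun m n => expfzDr m n x0) (expr0z x)).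
Qed.

(** Rewrites the product over a list depending on [m] as one over the fixed list [divisors n], so
    that products for different [m] can be interchanged. *)
Lemma prod_divisors_dvdn (R : Type) (idx : R) (op : Monoid.com_law idx)
    (F : nat -> R) (m n : nat) :
  (0 < n)%N -> (m %| n)%N ->
  \big[op/idx]_(d <- divisors m) F d
    = \big[op/idx]_(d <- divisors n | (d %| m)%N) F d.
Proof.
move=> n0 mn; rewrite -[RHS]big_filter; apply/perm_big/uniq_perm.
- exact: divisors_uniq.
- exact/filter_uniq/divisors_uniq.
move=> d; rewrite mem_filter -!dvdn_divisors ?(dvdn_gt0 n0 mn) //.
by case dm: (d %| m)%N => //=; rewrite (dvdn_trans dm mn).
Qed.

Lemma tofrac_prod (R : idomainType) (I : Type) (s : seq I) (P : pred I)
    (F : I -> R) :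
  tofrac (\prod_(i <- s | P i) F i) = \prod_(i <- s | P i) tofrac (F i).
Proof. exact: rmorph_prod. Qed.

(** Expand the product over all [i] of [x_i + 1], where [x_i] is -1 if [P i] holds and 0 otherwise:
    a subset not contained in [P] contributes 0, and a single [i] with [P i] makes the whole product
    vanish. *)
Lemma sum_sign_subset (T : finType) (P : pred T) :
  \sum_(I : {set T} | [forall i in I, P i]) (-1) ^+ #|I|
    = ([forall i, ~~ P i] : nat)%:R :> int.
Proof.
transitivity (\prod_(i : T) ((if P i then -1 else 0) + 1) : int).
  rewrite bigA_distr [LHS]big_mkcond /=; apply: eq_bigr => I _.
  rewrite -big_mkcond /=; case: ifPn => [/forall_inP PI | ].
    rewrite -prodr_const; apply: eq_bigr => i /PI -> //.
  by case/forall_inPn=> i iI /negPf Pi; rewrite (bigD1 i) //= Pi mul0r.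
case: (boolP [forall i, ~~ P i]) => [/forallP nP | /forallPn[i]]; last first.
  by rewrite negbK => Pi; rewrite (bigD1 i) //= Pi addNr mul0r.
by rewrite big1 // => i _; rewrite (negPf (nP i)) add0r.
Qed.

Lemma coprime_bigprod (I : Type) (s : seq I) (P : pred I) (F : I -> nat)
    (m : nat) :
  (forall i, P i -> coprime m (F i)) ->
  coprime m (\prod_(i <- s | P i) F i)%N.
Proof.
move=> co_m; elim/big_ind: _ => [|a b ma mb|//]; first exact: coprimen1.
by rewrite coprimeMr ma.
Qed.

Section PairwiseCoprime.

Variables (s : nat) (r : 'I_s -> nat).
Hypotheses (r_gt1 : forall i, (1 < r i)%N)
  (r_coprime : forall i j, i != j -> coprime (r i) (r j)).

Lemma prod_rho_gt0 : (0 < prod_rho r)%N.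
Proof. by apply: prodn_gt0 => i; apply: ltnW. Qed.

Lemma prod_rho_split (I : {set 'I_s}) :
  prod_rho r = (\prod_(i in I) r i * \prod_(i in ~: I) r i)%N.
Proof.
rewrite /prod_rho (bigID (mem I)) /=; congr (_ * _)%N.
by apply: eq_bigl => i; rewrite inE.
Qed.

Lemma prod_rho_div (I : {set 'I_s}) :
  (prod_rho r %/ \prod_(i in I) r i = \prod_(i in ~: I) r i)%N.
Proof.
by rewrite (prod_rho_split I) mulKn // prodn_cond_gt0 // => i _; apply: ltnW.
Qed.

(** The quotient is the product of the [r j] with [j] outside [I], which is coprime to each [r i]
    with [i] in [I]; hence so is any divisor of it. The converse is Gauss's lemma. *)
Lemma dvdn_prod_rho_div (I : {set 'I_s}) (d : nat) : (d %| prod_rho r)%N ->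
  (d %| prod_rho r %/ \prod_(i in I) r i)%N = [forall i in I, coprime d (r i)].
Proof.
rewrite prod_rho_div (prod_rho_split I) => d_dvd.
apply/idP/forall_inP => [d_dvdC i iI | co_d].
  apply: coprime_dvdl d_dvdC _; rewrite coprime_sym.
  apply: coprime_bigprod => j; rewrite inE => /negP jI.
  by apply: r_coprime; apply: contra_notN jI => /eqP <-.
by move: d_dvd; rewrite Gauss_dvdr //; apply: coprime_bigprod.
Qed.

End PairwiseCoprime.

Theorem theorem2 (s : nat) (r : 'I_s -> nat)
    (r_gt1 : forall i : 'I_s, (1 < r i)%N)
    (r_coprime : forall i j : 'I_s, i != j -> coprime (r i) (r j)) :
  Q_rho r = tofrac (\prod_(d <- D_rho r) 'Phi_d).
Proof.
have n0 := prod_rho_gt0 r_gt1.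
have Phi_neq0 d : tofrac 'Phi_d != 0 :> {fraction {poly int}}.
  by rewrite tofrac_eq0 monic_neq0 ?Cyclotomic_monic.
transitivity (\prod_(I : {set 'I_s}) \prod_(d <- divisors (prod_rho r) |
    (d %| prod_rho r %/ \prod_(i in I) r i)%N) tofrac 'Phi_d ^ ((-1) ^+ #|I|)).
  apply: eq_bigr => I _.
  have dvd_n : (prod_rho r %/ \prod_(i in I) r i %| prod_rho r)%N.
    by rewrite prod_rho_div // (prod_rho_split _ I) dvdn_mull.
  rewrite -prod_Cyclotomic ?(dvdn_gt0 n0) // (prod_divisors_dvdn _ _ n0 dvd_n).
  rewrite tofrac_prod.
  (* For a fixed exponent, even a negative one, the power map is multiplicative in a field. *)
  exact: (big_morph _ (fun x y => expfzMl x y _) (exp1rz _ _)).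
rewrite (exchange_big_dep xpredT) //= /D_rho big_filter tofrac_prod.
(* Both sides become products over all divisors of [prod_rho r], compared factor by factor with [d]
   known to divide it. *)
rewrite [RHS]big_mkcond /= big_seq [RHS]big_seq; apply: eq_bigr => d.
rewrite -dvdn_divisors // => d_dvd.
rewrite prod_exprz //.
rewrite (eq_bigl _ _ (fun I => dvdn_prod_rho_div r_gt1 r_coprime I d_dvd)).
rewrite sum_sign_subset.
(* As [r i] is positive, so is the gcd; being different from 1 then means exceeding 1. *)
have -> : [forall i, ~~ coprime d (r i)] = [forall i, 1 < gcdn d (r i)]%N.
  apply: eq_forallb => i; rewrite /coprime ltn_neqAle eq_sym gcdn_gt0.
  by rewrite (ltnW (r_gt1 i)) orbT andbT.
by case: ifP; rewrite ?expr1z ?expr0z.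
Qed.
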